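(* For every irrational $\theta$, the strictly heavy set $H^*_{\theta}$ is a singleton, i.e. there is exactly one $x\in[0,1)$ such that $S_n(x)>0$ for all integers $n\ge 1$.
   Context: Let $S^1=\mathbb{R}/\mathbb{Z}$ be the unit circle, identified with $[0,1)$ with addition modulo one. For irrational $\theta$ define $f(x)=\chi_{[0,1/2]}(x)-\chi_{(1/2,1)}(x)$ (difference of indicator functions, $x\in[0,1)$), $T(x)=x+\theta \bmod 1$, and $S_n(x)=\sum_{i=0}^{n-1} f(T^i(x))$. The strictly heavy set is $H^*_{\theta}=\{x\in[0,1): S_n(x)>0 \text{ for all } n=1,2,\ldots\}$. *)

(* Defs.v *)
From mathcomp Require Import all_boot all_order all_algebra.
From mathcomp Require Import classical_sets functions set_interval reals numfun.

Set Implicit Arguments.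
Unset Strict Implicit.
Unset Printing Implicit Defensive.

Import Order.TTheory GRing.Theory Num.Theory.

Local Open Scope classical_set_scope.
Local Open Scope ring_scope.

(* The circle R/Z is represented by its fundamental domain [0, 1). *)
Definition mod1 (R : realType) (y : R) : R := y - (Num.floor y)%:~R.

Definition rot (R : realType) (theta x : R) : R := mod1 (x + theta).

(* Only the values on [0, 1) matter; the function is 0 elsewhere. *)
Definition half_sign (R : realType) (x : R) : R :=
  \1_(`[0, 2^-1]) x - \1_(`]2^-1, 1[) x.

Definition birkhoff_sum (R : realType) (theta : R) (n : nat) (x : R) : R :=
  \sum_(i < n) half_sign (iter i (rot theta) x).

Definition strictly_heavy (R : realType) (theta : R) : set R :=
  [set x | `[0, 1[%classic x /\
           forall n : nat, (1 <= n)%N -> 0 < birkhoff_sum theta n x].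

(* Main.v *)
(* Since [theta] is irrational it is enclosed by infinitely many Farey pairs
   whose two denominators are both odd, and one member [p / q] of each such
   pair satisfies [|theta - p / q| <= 1 / (2 q ^ 2)].  For such a fraction the
   first [q] points of a [theta]-orbit drift by less than [1 / (2 q)] from the
   [p / q]-orbit, so their signs are dominated by those of the rational
   rotation at a nearby point of the grid.  The signs of the rational rotation
   sum to [1] over a period, so by the cycle lemma exactly one starting point
   modulo [q] has positive partial sums.  Hence two strictly heavy points are
   at distance at most [3 / (2 q)] on the circle, for arbitrarily large [q].
   Conversely the good starting points give points whose first [q] sums are
   positive, and as the sign function is upper semicontinuous on the circle any
   cluster point of them is strictly heavy. *)

Require Import Defs.
From mathcomp Require Import all_boot all_order all_algebra.
From mathcomp Require Import classical_sets functions set_interval reals numfun.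
From mathcomp Require Import boolp topology normedtype.
From mathcomp Require Import zify ring lra.

Set Implicit Arguments.
Unset Strict Implicit.
Unset Printing Implicit Defensive.

Import Order.TTheory GRing.Theory Num.Theory.
Import numFieldNormedType.Exports.

Local Open Scope classical_set_scope.
Local Open Scope ring_scope.

(** * Signs and orbit sums lifted to the real line *)

(** Being 1-periodic on all of [R], it lets orbits be written [x + theta *+ i] without reduction;
    integer values make a positive sum at least 1. *)
Definition circle_sign (R : realType) (z : R) : int :=
  if mod1 z <= 2^-1 then 1 else -1.

Definition orbit_sum (R : realType) (theta : R) (n : nat) (x : R) : int :=
  \sum_(i < n) circle_sign (x + theta *+ i).

Lemma mod1_itv (R : realType) (z : R) : 0 <= mod1 z < 1.
Proof.
have := floor_itv z; rewrite /mod1 intrD => /andP[? ?].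
by apply/andP; split; lra.
Qed.

Lemma mod1_id (R : realType) (z : R) : 0 <= z < 1 -> mod1 z = z.
Proof. by move=> z01; rewrite /mod1 (@floor_def _ z 0) ?subr0. Qed.

Lemma mod1Dz (R : realType) (z : R) (k : int) : mod1 (z + k%:~R) = mod1 z.
Proof.
by rewrite /mod1 floorDrz ?rpred_int // intrKfloor intrD; ring.
Qed.

Lemma circle_signDz (R : realType) (z : R) (k : int) :
  circle_sign (z + k%:~R) = circle_sign z.
Proof. by rewrite /circle_sign mod1Dz. Qed.

Lemma mod1_rot (R : realType) (theta z : R) :
  Defs.rot theta (mod1 z) = mod1 (z + theta).
Proof.
by rewrite /Defs.rot {2}/mod1 addrAC -[- _]intrN mod1Dz.
Qed.

Lemma iter_rot (R : realType) (theta z : R) (i : nat) :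
  iter i (Defs.rot theta) (mod1 z) = mod1 (z + theta *+ i).
Proof.
elim: i => [|i IH]; first by rewrite mulr0n addr0.
by rewrite iterS IH mod1_rot mulrSr addrA.
Qed.

Lemma half_sign_mod1 (R : realType) (z : R) :
  half_sign (mod1 z) = (circle_sign z)%:~R.
Proof.
rewrite /half_sign /circle_sign !indicE !mem_setE !in_itv /=.
have /andP[z0 z1] := mod1_itv z.
rewrite z0 z1 andbT /= ltNge.
by case: ifP => _ /=; rewrite ?subr0 ?sub0r.
Qed.

Lemma birkhoff_sumE (R : realType) (theta x : R) (n : nat) :
  birkhoff_sum theta n (mod1 x) = (orbit_sum theta n x)%:~R.
Proof.
rewrite /birkhoff_sum /orbit_sum raddf_sum /=; apply: eq_bigr => i _.
by rewrite iter_rot half_sign_mod1.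
Qed.

Lemma orbit_sum_mod1 (R : realType) (theta x : R) (n : nat) :
  orbit_sum theta n (mod1 x) = orbit_sum theta n x.
Proof.
apply: eq_bigr => i _.
by rewrite /mod1 addrAC -[- _%:~R]intrN circle_signDz.
Qed.

Lemma circle_sign_eq1P (R : realType) (z : R) :
  reflect (exists k : int, k%:~R <= z <= k%:~R + 2^-1) (circle_sign z == 1).
Proof.
rewrite /circle_sign; apply: (iffP idP) => [|[k /andP[kz zk]]].
  case: ifP => // zle _; exists (Num.floor z).
  have := mod1_itv z; rewrite /mod1 in zle * => /andP[? ?].
  by apply/andP; split; lra.
suff -> : mod1 z = z - k%:~R by rewrite ifT //; lra.
by rewrite /mod1 (@floor_def _ z k) // kz intrD; lra.
Qed.

Lemma circle_sign_pm1 (R : realType) (z : R) :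
  circle_sign z = 1 \/ circle_sign z = -1.
Proof. by rewrite /circle_sign; case: ifP; [left|right]. Qed.

(** * Signs on the grid of odd order, compared with signs on the circle *)

(* With [q = 2 m + 1], the common sign of the circle points [j / q] and
   [(2 j + 1) / (2 q)]; [q] odd is what makes the two agree. *)
Definition lattice_sign (m : nat) (j : int) : int :=
  if (j %% m.*2.+1)%Z <= m%:Z then 1 else -1.

Lemma lattice_sign_mod (m : nat) (j : int) :
  lattice_sign m (j %% m.*2.+1)%Z = lattice_sign m j.
Proof. by rewrite /lattice_sign modz_mod. Qed.

Lemma lattice_sign_pm1 (m : nat) (j : int) :
  lattice_sign m j = 1 \/ lattice_sign m j = -1.
Proof. by rewrite /lattice_sign; case: ifP; [left|right]. Qed.

Lemma lattice_sign_eq1 (m : nat) (j : int) :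
  lattice_sign m j = 1 <->
  exists k : int, 0 <= j - k * m.*2.+1%:Z <= m%:Z.
Proof.
split.
  rewrite /lattice_sign; case: ifP => // jm _.
  exists (j %/ m.*2.+1)%Z; rewrite {1 3}(divz_eq j m.*2.+1%:Z).
  by rewrite [X in X - _]addrC addrK jm modz_ge0.
move=> [k /andP[j0 jm]].
rewrite /lattice_sign ifT //.
have -> : j = k * m.*2.+1%:Z + (j - k * m.*2.+1%:Z) by ring.
by rewrite modzMDl modz_small //; lia.
Qed.

(** If [z] lies in [[k, k + 1/2]], then [i = j - k q] satisfies [-2 < 2 i < q + 1]. As
    [q + 1 = 2 m + 2], integrality rounds this to [0 <= i <= m]. *)
Lemma circle_sign_le_lattice (R : realType) (m : nat) (z : R) (j : int) :
  2 * j%:~R - 1 < 2 * m.*2.+1%:R * z < 2 * j%:~R + 2 ->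
  circle_sign z <= lattice_sign m j.
Proof.
move=> /andP[jz zj].
have [/eqP/circle_sign_eq1P[k /andP[kz zk]]|->] := circle_sign_pm1 z; last first.
  by have [->|->] := lattice_sign_pm1 m j.
suff -> : lattice_sign m j = 1 by rewrite /circle_sign; case: ifP.
apply/lattice_sign_eq1; exists k.
pose i := j - k * m.*2.+1%:Z.
have q0 : (0 : R) < m.*2.+1%:R by rewrite ltr0n.
have iE : i%:~R = j%:~R - k%:~R * m.*2.+1%:R :> R by rewrite intrB intrM.
have i0 : (-2 : int)%:~R < (2 * i)%:~R :> R.
  by rewrite [(2 * i)%:~R]intrM iE; nra.
have im : (2 * i)%:~R < (m.*2.+1%:Z + 1)%:~R :> R.
  rewrite intrM intrD iE.
  have -> : (m.*2.+1%:Z)%:~R = m.*2.+1%:R :> R by [].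
  by nra.
rewrite !ltr_int in i0 im.
by rewrite -/i; apply/andP; split; lia.
Qed.

(** From [0 <= j - k q <= m] one gets [0 <= 2 q (z - k) <= 2 m + 1], and the last bound is exactly
    [q]. *)
Lemma lattice_le_circle_sign (R : realType) (m : nat) (z : R) (j : int) :
  2 * j%:~R <= 2 * m.*2.+1%:R * z <= 2 * j%:~R + 1 ->
  lattice_sign m j <= circle_sign z.
Proof.
move=> /andP[jz zj].
have [/lattice_sign_eq1[k /andP[j0 jm]]|->] := lattice_sign_pm1 m j; last first.
  by have [->|->] := circle_sign_pm1 z.
suff /eqP-> : circle_sign z == 1 by rewrite /lattice_sign; case: ifP.
apply/circle_sign_eq1P; exists k.
move: j0 jm; rewrite -(ler_int R) -[_ <= m%:Z](ler_int R) intrB intrM.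
have -> : (m.*2.+1%:Z)%:~R = m.*2.+1%:R :> R by [].
have q0 : (0 : R) < m.*2.+1%:R by rewrite ltr0n.
have qE : m.*2.+1%:R = 2 * m%:R + 1 :> R by rewrite -addn1 natrD -muln2 natrM; ring.
have -> : (m%:Z)%:~R = m%:R :> R by [].
move=> j0 jm.
move: (m.*2.+1%:R) q0 qE jz zj j0 jm => q q0 qE jz zj j0 jm.
have h1 : 0 <= q * (z - k%:~R) by lra.
have h2 : 0 <= q * (k%:~R + 2^-1 - z) by lra.
rewrite !pmulr_rge0 // in h1 h2.
by apply/andP; split; lra.
Qed.

(** * Rational rotations and the cycle lemma *)

Definition lattice_sum (m : nat) (p j : int) (n : nat) : int :=
  \sum_(i < n) lattice_sign m (j + p * i%:Z).

Lemma lattice_sumD (m : nat) (p j : int) (a b : nat) :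
  lattice_sum m p j (a + b) =
  lattice_sum m p j a + lattice_sum m p (j + p * a%:Z) b.
Proof.
rewrite /lattice_sum big_split_ord /=; congr (_ + _).
by apply: eq_bigr => i _; rewrite PoszD mulrDr addrA.
Qed.

Lemma lattice_sum_eqmod (m : nat) (p j j' : int) (n : nat) :
  (j = j' %[mod m.*2.+1])%Z -> lattice_sum m p j n = lattice_sum m p j' n.
Proof.
move=> jj'; apply: eq_bigr => i _.
by rewrite -lattice_sign_mod -modzDml jj' modzDml lattice_sign_mod.
Qed.

Lemma sum_lattice_sign (m : nat) : \sum_(i < m.*2.+1) lattice_sign m i%:Z = 1.
Proof.
have E : (m.*2.+1 = m.+1 + m)%N by rewrite -addnn addSn.
have -> : \sum_(i < m.*2.+1) lattice_sign m i%:Z =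
          \sum_(i < m.+1 + m) lattice_sign m i%:Z by rewrite -E.
have sgE (i : nat) : (i < m.*2.+1)%N ->
    lattice_sign m i%:Z = if (i <= m)%N then 1 else -1.
  by move=> lt_i; rewrite /lattice_sign modz_small.
rewrite big_split_ord /=.
under eq_bigr => i _.
  rewrite sgE; last by have := ltn_ord i; lia.
  rewrite -ltnS ltn_ord; over.
under [X in _ + X]eq_bigr => i _.
  rewrite sgE; last by have := ltn_ord i; lia.
  rewrite leqNgt ltnS leq_addr; over.
by rewrite !sumr_const !card_ord mulrSr mulNrn -addrAC addrN add0r.
Qed.

Section Rotation.
Variables (m : nat) (p : int).
Hypothesis pq : coprimez p m.*2.+1.

Let step_inj (j : int) (i i' : nat) : (i < m.*2.+1)%N -> (i' < m.*2.+1)%N ->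
  (j + p * i%:Z = j + p * i'%:Z %[mod m.*2.+1])%Z -> i = i'.
Proof.
move=> lti lti' /eqP; rewrite eqz_mod_dvd.
have -> : j + p * i%:Z - (j + p * i'%:Z) = p * (i%:Z - i'%:Z) by ring.
rewrite Gauss_dvdzr; last by rewrite coprimez_sym.
by rewrite -eqz_mod_dvd !modz_small // => /eqP[].
Qed.

Let step (j : int) (i : 'I_m.*2.+1) : 'I_m.*2.+1 :=
  inord `|((j + p * i%:Z) %% m.*2.+1)%Z|.

Let stepE (j : int) (i : 'I_m.*2.+1) :
  (step j i)%:Z = ((j + p * i%:Z) %% m.*2.+1)%Z.
Proof.
have h0 : (0 <= (j + p * i%:Z) %% m.*2.+1)%Z by rewrite modz_ge0.
have h1 : ((j + p * i%:Z) %% m.*2.+1 < m.*2.+1)%Z by rewrite ltz_pmod.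
by rewrite inordK ?gez0_abs //; lia.
Qed.

Let step_bij (j : int) : injective (step j).
Proof.
move=> i i' /(congr1 (fun k : 'I__ => k%:Z)); rewrite !stepE => h.
by apply/val_inj/(step_inj (ltn_ord i) (ltn_ord i') h).
Qed.

(** Coprimality makes [i -> j + p i] a permutation of the residues, which carry [m + 1] plus signs
    and [m] minus signs. *)
Lemma lattice_sum_period (j : int) : lattice_sum m p j m.*2.+1 = 1.
Proof.
rewrite -[RHS](sum_lattice_sign m) (reindex_inj (@step_bij j)).
by apply: eq_bigr => i _; rewrite stepE lattice_sign_mod.
Qed.

Lemma orbit_surj (j j' : int) : exists2 i : nat,
  (i < m.*2.+1)%N & (j' = j + p * i%:Z %[mod m.*2.+1])%Z.
Proof.
pose k : 'I_m.*2.+1 := inord `|(j' %% m.*2.+1)%Z|.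
have kE : k%:Z = (j' %% m.*2.+1)%Z.
  have h0 : (0 <= j' %% m.*2.+1)%Z by rewrite modz_ge0.
  have h1 : (j' %% m.*2.+1 < m.*2.+1)%Z by rewrite ltz_pmod.
  by rewrite inordK ?gez0_abs //; lia.
have [g _ gK] := injF_bij (@step_bij j).
by exists (g k) => //; rewrite -stepE gK kE.
Qed.

(* Two distinct good starting points would cut the period into two arcs, each
   of sum at least [1]. *)
Lemma lattice_sum_gt0_uniq (j j' : int) :
  (forall n, (0 < n <= m.*2.+1)%N -> 0 < lattice_sum m p j n) ->
  (forall n, (0 < n <= m.*2.+1)%N -> 0 < lattice_sum m p j' n) ->
  (j = j' %[mod m.*2.+1])%Z.
Proof.
move=> Hj Hj'; have [i lti Ei] := orbit_surj j j'.
have [i0|i0] := posnP i; first by rewrite Ei i0 mulr0 addr0.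
have h1 := Hj i; have h2 := Hj' (m.*2.+1 - i)%N.
rewrite (lattice_sum_eqmod _ _ Ei) in h2.
have := lattice_sumD m p j i (m.*2.+1 - i).
rewrite subnKC ?lattice_sum_period; last exact: ltnW.
by lia.
Qed.

(* [s n * q - n], with [s] the partial sums, has period [q]; start where it is minimal. *)
Lemma lattice_sum_gt0_exists :
  exists j, forall n, (0 < n)%N -> 0 < lattice_sum m p j n.
Proof.
pose q := m.*2.+1; pose s := lattice_sum m p 0.
pose w (n : nat) : int := s n * q%:Z - n%:Z.
have wq n : w (n + q)%N = w n.
  rewrite /w /s addnC lattice_sumD lattice_sum_period add0r.
  rewrite (@lattice_sum_eqmod m p (p * q%:Z) 0).
    by rewrite PoszD; ring.
  by rewrite -[p * _]addr0 modzMDl.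
have wmod n : w n = w (n %% q)%N.
  rewrite {1}(divn_eq n q); elim: (n %/ q)%N => [|k IH]; first by rewrite add0n.
  by rewrite mulSn -addnA addnC wq.
pose t : 'I_q := [arg min_(i < (ord0 : 'I_q)) w i]%O.
have tmin (n : nat) : w t <= w n.
  rewrite /t; case: arg_minP => //= i _ /(_ (inord (n %% q)) isT).
  by rewrite inordK ?ltn_mod // -wmod.
exists (p * t%:Z) => n n0.
have := tmin (t + n)%N; rewrite /w /s lattice_sumD add0r.
set a := lattice_sum m p 0 t; set b := lattice_sum m p _ n.
rewrite PoszD mulrDl => h.
have {}h : n%:Z <= b * q%:Z by lia.
have : 0 < b * q%:Z by lia.
by rewrite pmulr_lgt0.
Qed.

End Rotation.

(** * Approximation by fractions with odd denominator *)

Lemma irrational_neq (R : realType) (theta : R) (p : int) (m : nat) :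
  irrational theta -> m.+1%:R * theta != p%:~R.
Proof.
move=> irr; apply/eqP => h; apply/irr/rationalP; exists p, m.+1.
by rewrite -h mulrC mulKf // pnatr_eq0.
Qed.

Lemma irrationalN (R : realType) (theta : R) :
  irrational theta -> irrational (- theta).
Proof.
move=> irr /rationalP[a [b h]]; apply/irr/rationalP; exists (- a), b.
by rewrite intrN mulNr -h opprK.
Qed.

(* [p / (2 m + 1) < theta < p' / (2 m' + 1)], with unit determinant. *)
Definition odd_farey (R : realType) (theta : R) (p : int) (m : nat)
    (p' : int) (m' : nat) : Prop :=
  [/\ 0 < m.*2.+1%:R * theta - p%:~R, 0 < p'%:~R - m'.*2.+1%:R * theta &
      p' * m.*2.+1%:Z - p * m'.*2.+1%:Z = 1].

(** This reflection reduces the case of [theta] left of the mediant to the case right of it. *)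
Lemma odd_fareyN (R : realType) (theta : R) (p : int) (m : nat)
    (p' : int) (m' : nat) :
  odd_farey theta p m p' m' -> odd_farey (- theta) (- p') m' (- p) m.
Proof.
move=> [h1 h2 h3]; split; last by rewrite -h3; ring.
  by rewrite intrN; lra.
by rewrite intrN; lra.
Qed.

Lemma double_S_R (R : realType) (m : nat) : m.*2.+1%:R = 2 * m%:R + 1 :> R.
Proof. by rewrite -addn1 natrD -muln2 natrM mulrC. Qed.

(* The mediant [P / Q] has an even denominator; between it and [p' / (2m'+1)] the
   fractions [(p' + k P) / (q' + k Q)] all have odd denominators. *)
Lemma odd_farey_right (R : realType) (theta : R) (p : int) (m : nat)
    (p' : int) (m' : nat) :
  irrational theta -> odd_farey theta p m p' m' ->
  p'%:~R - m'.*2.+1%:R * theta < m.*2.+1%:R * theta - p%:~R ->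
  exists r n r' n', odd_farey theta r n r' n' /\ (m + m' < n + n')%N.
Proof.
move=> irr [a0 b0 det1] ba.
set a := _ - p%:~R in a0 ba; set b := p'%:~R - _ in b0 ba.
have g0 : 0 < a - b by rewrite subr_gt0.
(* The [i]-th fraction has gap [b - i (a - b)], so [k] is the last index where it is still above
   [theta]; fractions [k + 1] and [k] form the new pair. *)
pose k := Num.truncn (b / (a - b)).
have /andP[kb bk] : k%:R <= b / (a - b) < k.+1%:R.
  by apply: Num.Theory.truncn_itv; rewrite divr_ge0 ?ltW.
rewrite ler_pdivlMr // in kb; rewrite ltr_pdivrMr // in bk.
pose n (k : nat) : nat := (m' + k * (m + m').+1)%N.
pose r (k : nat) : int := p' + k%:Z * (p + p').
have nE (i : nat) : (n i).*2.+1 = (m'.*2.+1 + i * (m.*2.+1 + m'.*2.+1))%N.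
  by rewrite /n -!muln2; lia.
have rE (i : nat) : (r i)%:~R - (n i).*2.+1%:R * theta = b - i%:R * (a - b).
  rewrite nE natrD natrM natrD /r intrD intrM intrD /a /b.
  have -> : (i%:Z)%:~R = i%:R :> R by [].
  by ring.
exists (r k.+1), (n k.+1), (r k), (n k); split; last by rewrite /n; lia.
split.
- by rewrite -opprB rE oppr_gt0 subr_lt0.
- have : (r k)%:~R - (n k).*2.+1%:R * theta != 0.
    by rewrite subr_eq0 eq_sym irrational_neq.
  by rewrite rE lt_def => ->; rewrite subr_ge0.
- by rewrite !nE /r; lia.
Qed.

Lemma odd_farey_step (R : realType) (theta : R) (p : int) (m : nat)
    (p' : int) (m' : nat) :
  irrational theta -> odd_farey theta p m p' m' ->
  exists r n r' n', odd_farey theta r n r' n' /\ (m + m' < n + n')%N.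
Proof.
move=> irr F.
have [ab|ba|/eqP] := ltgtP (m.*2.+1%:R * theta - p%:~R)
                      (p'%:~R - m'.*2.+1%:R * theta).
- have [|r [n [r' [n' [F' lt_n]]]]] :=
    odd_farey_right (irrationalN irr) (odd_fareyN F).
    by rewrite !intrN; lra.
  exists (- r'), n', (- r), n; split; last by lia.
  by rewrite -(opprK theta); apply: odd_fareyN.
- exact: odd_farey_right irr F ba.
(* Equal gaps would make [theta] the mediant [(p + p') / (q + q')]. *)
- have := irrational_neq (p + p') (m.*2.+1 + m'.*2)%N irr.
  rewrite -addnS natrD intrD => /eqP ne /eqP h; case: ne; lra.
Qed.

Lemma odd_farey_large (R : realType) (theta : R) (N : nat) :
  irrational theta ->
  exists p m p' m', odd_farey theta p m p' m' /\ (N <= m + m')%N.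
Proof.
move=> irr; elim: N => [|N [p [m [p' [m' [F leN]]]]]]; last first.
  have [r [n [r' [n' [F' lt_n]]]]] := odd_farey_step irr F.
  by exists r, n, r', n'; split => //; apply: leq_ltn_trans leN lt_n.
exists (Num.floor theta), 0%N, (Num.floor theta + 1), 0%N; split => //.
split; last by lia.
  have := floor_le theta; have := irrational_neq (Num.floor theta) 0 irr.
  by rewrite mul1r subr_gt0 lt_def => ->.
by rewrite mul1r subr_gt0 floorD1_gt.
Qed.

(** Only finitely many denominators occur, each with a positive distance to the integers. This
    serves to make both denominators of a pair large, as [odd_farey_large] controls only their
    sum. *)
Lemma irrational_away (R : realType) (theta : R) (Q : nat) :
  irrational theta -> exists2 d : R, 0 < d &
  forall (q : nat) (p : int), (q < Q)%N -> d <= `|q.+1%:R * theta - p%:~R|.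
Proof.
move=> irr; elim: Q => [|Q [d d0 IH]]; first by exists 1.
pose z := Q.+1%:R * theta; pose f := z - (Num.floor z)%:~R.
have f0 : 0 < f.
  rewrite subr_gt0 lt_def floor_le andbT.
  exact: irrational_neq.
have f1 : f < 1.
  by have := floorD1_gt z; rewrite intrD /f; lra.
exists (Num.min d (Num.min f (1 - f))) => [|q p].
  by rewrite !lt_min d0 f0 subr_gt0.
rewrite ltnS leq_eqVlt => /orP[/eqP->|ltq]; last first.
  by rewrite ge_min IH.
rewrite -/z !ge_min.
have [le_p|lt_p] := leP p (Num.floor z).
  have : p%:~R <= (Num.floor z)%:~R :> R by rewrite ler_int.
  move=> h; have hf : f <= `|z - p%:~R|.
    by rewrite (le_trans _ (ler_norm _)) // /f; lra.
  by rewrite hf orbT.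
have : (Num.floor z + 1)%:~R <= p%:~R :> R by rewrite ler_int; lia.
rewrite intrD => h; have hf : 1 - f <= `|z - p%:~R|.
  by rewrite distrC (le_trans _ (ler_norm _)) // /f; lra.
by rewrite hf !orbT.
Qed.

Lemma odd_farey_identity (R : realType) (theta : R) (p : int) (m : nat)
    (p' : int) (m' : nat) : odd_farey theta p m p' m' ->
  m'.*2.+1%:R * (m.*2.+1%:R * theta - p%:~R) +
  m.*2.+1%:R * (p'%:~R - m'.*2.+1%:R * theta) = 1.
Proof.
case=> _ _ /(congr1 (fun z : int => z%:~R : R)).
rewrite intrB !intrM => h.
by transitivity (p'%:~R * m.*2.+1%:R - p%:~R * m'.*2.+1%:R : R); [ring|].
Qed.

Lemma odd_farey_coprime (R : realType) (theta : R) (p : int) (m : nat)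
    (p' : int) (m' : nat) : odd_farey theta p m p' m' ->
  coprimez p m.*2.+1 /\ coprimez p' m'.*2.+1.
Proof.
case=> _ _ h; split; apply/coprimezP.
  by exists (- m'.*2.+1%:Z, p') => /=; rewrite -h; ring.
by exists (m.*2.+1%:Z, - p) => /=; rewrite -h; ring.
Qed.

(** With gaps [a], [b] and [q' a + q b = 1], failure of both members means [2 q a > 1] and
    [2 q' b > 1]; weighting these by [q'^2] and [q^2] gives [q'^2 + q^2 < 2 q q'], which is
    absurd. *)
Lemma odd_approximation (R : realType) (theta : R) (N : nat) :
  irrational theta -> exists (m : nat) (p : int),
  [/\ (N <= m)%N, coprimez p m.*2.+1 &
      2 * m.*2.+1%:R * `|m.*2.+1%:R * theta - p%:~R| <= 1].
Proof.
move=> irr; have [d d0 away] := irrational_away N.*2 irr.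
pose M := Num.truncn d^-1.
have dM (x : R) (n : nat) : d <= x -> n.+1%:R * x < 1 -> (n < M)%N.
  move=> dx nx; have d1 : n.+1%:R <= d^-1.
    rewrite -[d^-1]mul1r ler_pdivlMr // ltW // (le_lt_trans _ nx) //.
    by rewrite ler_pM2l // ltr0n.
  have := Num.Theory.truncn_itv (ltW (_ : 0 < d^-1)).
  rewrite invr_gt0 d0 => /(_ isT)/andP[_ lt].
  by rewrite -/M -ltnS -(ltr_nat R) (le_lt_trans d1).
have [p [m [p' [m' [F leM]]]]] := odd_farey_large (N + M) irr.
have [a0 b0 _] := F; have id1 := odd_farey_identity F.
have [cop cop'] := odd_farey_coprime F.
have q0 : (0 : R) < m.*2.+1%:R by rewrite ltr0n.
have q0' : (0 : R) < m'.*2.+1%:R by rewrite ltr0n.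
(* A small [m] forces [a >= d], and [q' a < 1] then bounds [2 m'] by [M], so [m + m'] would stay
   below [N + M]. *)
have Nm : (N <= m)%N.
  have [//|ltN] := leqP N m.
  have := away m.*2 p; rewrite ltn_double ltN (gtr0_norm a0) => /(_ isT) da.
  have /(dM _ _ da) : m'.*2.+1%:R * (m.*2.+1%:R * theta - p%:~R) < 1.
    by rewrite -[ltRHS]id1 ltrDl mulr_gt0.
  by lia.
have Nm' : (N <= m')%N.
  have [//|ltN] := leqP N m'.
  have := away m'.*2 p'; rewrite ltn_double ltN distrC (gtr0_norm b0).
  move=> /(_ isT) da.
  have /(dM _ _ da) : m.*2.+1%:R * (p'%:~R - m'.*2.+1%:R * theta) < 1.
    by rewrite -[ltRHS]id1 ltrDr mulr_gt0.
  by lia.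
have [h|h] := leP (2 * m.*2.+1%:R * (m.*2.+1%:R * theta - p%:~R)) 1.
  by exists m, p; split; rewrite // gtr0_norm.
exists m', p'; split; rewrite // distrC gtr0_norm //.
rewrite leNgt; apply/negP => h'.
move: (m.*2.+1%:R) (m'.*2.+1%:R) (p%:~R) (p'%:~R) q0 q0' a0 b0 id1 h h'.
move=> q q' u u' q0 q0'.
set a := _ - u; set b := u' - _ => a0 b0 id1 h h'.
have e1 : q' ^+ 2 < q' ^+ 2 * (2 * q * a) by rewrite ltr_pMr // exprn_gt0.
have e2 : q ^+ 2 < q ^+ 2 * (2 * q' * b) by rewrite ltr_pMr // exprn_gt0.
have e3 : q' ^+ 2 * (2 * q * a) + q ^+ 2 * (2 * q' * b) = 2 * q * q'.
  by rewrite -[RHS]mulr1 -id1; ring.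
have := sqr_ge0 (q - q'); nra.
Qed.

(** * Comparison of the orbit of [theta] with the rational orbit *)

Section Comparison.
Variables (R : realType) (theta : R) (m : nat) (p : int).
Hypothesis approx : 2 * m.*2.+1%:R * `|m.*2.+1%:R * theta - p%:~R| <= 1.

Let e : R := m.*2.+1%:R * theta - p%:~R.

Let drift (i : nat) : (i < m.*2.+1)%N -> 2 * i%:R * `|e| < 1.
Proof.
move=> lti; have [->|e0] := eqVneq e 0; first by rewrite normr0 mulr0.
apply: lt_le_trans approx; rewrite -/e.
by rewrite ltr_pM2r ?normr_gt0 // ltr_pM2l // ltr_nat.
Qed.

Let orbitE (x : R) (i : nat) : 2 * m.*2.+1%:R * (x + theta *+ i) =
  2 * m.*2.+1%:R * x + 2 * (p * i%:Z)%:~R + 2 * i%:R * e.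
Proof.
rewrite intrM -[(i%:Z)%:~R]/(i%:R) -mulr_natr /e; ring.
Qed.

Lemma orbit_sum_le_lattice (x : R) : exists2 j : int,
  2 * j%:~R - 1 < 2 * m.*2.+1%:R * x < 2 * j%:~R + 2 &
  forall n, (n <= m.*2.+1)%N -> orbit_sum theta n x <= lattice_sum m p j n.
Proof.
suff [j hj] : exists j : int, 2 * j%:~R - 1 < 2 * m.*2.+1%:R * x < 2 * j%:~R + 2
    /\ forall i, (i < m.*2.+1)%N ->
       2 * j%:~R - 1 < 2 * m.*2.+1%:R * x + 2 * i%:R * e < 2 * j%:~R + 2.
  have [hx hi] := hj; exists j => // n le_n; apply: ler_sum => i _.
  apply: circle_sign_le_lattice; rewrite orbitE intrD.
  have /andP[h1 h2] := hi i (leq_trans (ltn_ord i) le_n).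
  by apply/andP; split; lra.
(* The window has length 3 and the drift is one-sided and below 1. So [2 q x] is placed in the lower
   two units by [ceil] when the drift is upward, in the upper two by [floor] when it is downward. *)
have [e0|e0] := leP 0 e.
  pose j := Num.ceil (m.*2.+1%:R * x - 2^-1); exists j.
  have /andP[] : (j - 1)%:~R < m.*2.+1%:R * x - 2^-1 <= j%:~R.
    exact: Num.Theory.ceil_itv.
  rewrite intrB => h1 h2; split; first by apply/andP; split; lra.
  move=> i /drift; rewrite ger0_norm // => h3.
  have h4 : 0 <= 2 * i%:R * e by rewrite !mulr_ge0.
  by apply/andP; split; lra.
pose j := Num.floor (m.*2.+1%:R * x); exists j.
have /andP[] : j%:~R <= m.*2.+1%:R * x < (j + 1)%:~R by exact: floor_itv.
rewrite intrD => h1 h2; split; first by apply/andP; split; lra.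
move=> i /drift; rewrite ltr0_norm // => h3.
have h4 : 0 <= 2 * i%:R * - e by rewrite !mulr_ge0 // oppr_ge0 ltW.
by apply/andP; split; lra.
Qed.

Lemma lattice_le_orbit_sum (j : int) : exists x : R,
  forall n, (n <= m.*2.+1)%N -> lattice_sum m p j n <= orbit_sum theta n x.
Proof.
suff [x hx] : exists x : R, forall i, (i < m.*2.+1)%N ->
    2 * j%:~R <= 2 * m.*2.+1%:R * x + 2 * i%:R * e <= 2 * j%:~R + 1.
  exists x => n le_n; apply: ler_sum => i _.
  apply: lattice_le_circle_sign; rewrite orbitE intrD.
  have /andP[h1 h2] := hx i (leq_trans (ltn_ord i) le_n).
  by apply/andP; split; lra.
have q0 : 2 * m.*2.+1%:R != 0 :> R by rewrite mulf_neq0 // pnatr_eq0.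
(* The window now has length 1, so the start is the end from which the drift points inward. *)
have [e0|e0] := leP 0 e.
  exists (2 * j%:~R / (2 * m.*2.+1%:R)) => i /drift.
  rewrite ger0_norm // mulrCA mulfV // mulr1 => h3.
  have h4 : 0 <= 2 * i%:R * e by rewrite !mulr_ge0.
  by apply/andP; split; lra.
exists ((2 * j%:~R + 1) / (2 * m.*2.+1%:R)) => i /drift.
rewrite ltr0_norm // mulrCA mulfV // mulr1 => h3.
have h4 : 0 <= 2 * i%:R * - e by rewrite !mulr_ge0 // oppr_ge0 ltW.
by apply/andP; split; lra.
Qed.

End Comparison.

(** * Uniqueness, and existence by compactness *)

Section StrictlyHeavy.
Variables (R : realType) (theta : R).
Hypothesis irr : irrational theta.

Lemma orbit_sum_gt0_uniq (x y : R) : 0 <= x < 1 -> 0 <= y < 1 ->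
  (forall n, (0 < n)%N -> 0 < orbit_sum theta n x) ->
  (forall n, (0 < n)%N -> 0 < orbit_sum theta n y) -> x = y.
Proof.
move=> /andP[x0 x1] /andP[y0 y1] Hx Hy.
apply/eqP/negPn/negP => xy.
(* The distance on the circle, that is, from [x - y] to the nearest integer. *)
pose d := Num.min `|x - y| (1 - `|x - y|).
have d1 : `|x - y| < 1 by rewrite ltr_norml; apply/andP; split; lra.
have d0 : 0 < d by rewrite lt_min normr_gt0 !subr_eq0 xy subr_gt0.
have [m [p [leN cop approx]]] :=
  odd_approximation (Num.truncn (2 / d)).+1 irr.
have dm : 3 < 2 * m.*2.+1%:R * d.
  have /andP[_ lt] := Num.Theory.truncn_itv (divr_ge0 (ler0n R 2) (ltW d0)).
  have : 2 / d < m%:R :> R by apply: lt_le_trans lt _; rewrite ler_nat.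
  rewrite ltr_pdivrMr // double_S_R => h; lra.
have [j /andP[j1 j2] Hj] := orbit_sum_le_lattice approx x.
have [k /andP[k1 k2] Hk] := orbit_sum_le_lattice approx y.
have /eqP : (j = k %[mod m.*2.+1])%Z.
  apply: (lattice_sum_gt0_uniq cop) => n /andP[n0 nq].
    exact: lt_le_trans (Hx n n0) (Hj n nq).
  exact: lt_le_trans (Hy n n0) (Hk n nq).
rewrite eqz_mod_dvd => /dvdzP[t jk].
have {}jk : j%:~R = k%:~R + t%:~R * m.*2.+1%:R :> R.
  by rewrite -(subrK k j) jk intrD intrM addrC.
have q0 : (0 : R) < 2 * m.*2.+1%:R by rewrite mulr_gt0 // ltr0n.
(* The two windows of length 3 are translates by [2 q t], so [2 q (x - y - t)] lies strictly between
   -3 and 3. *)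
have : `|x - y - t%:~R| < d.
  rewrite -(ltr_pM2l q0); apply: lt_trans dm.
  rewrite -[X in X * `|_|](gtr0_norm q0) -normrM ltr_norml.
  by apply/andP; split; nra.
rewrite lt_min => /andP[h1 h2].
have [t0|t0|t0] := ltgtP t 0.
- have : t%:~R <= (-1)%:~R :> R by rewrite ler_int; clear -t0; lia.
  by move=> t1; move: h2; rewrite !ltr_norml; have := ler_norm (x - y);
    have := ler_norm (y - x); rewrite (distrC y); lra.
- have : 1%:~R <= t%:~R :> R by rewrite ler_int; clear -t0; lia.
  by move=> t1; move: h2; rewrite !ltr_norml; have := ler_norm (x - y);
    have := ler_norm (y - x); rewrite (distrC y); lra.
- by move: h1; rewrite t0 subr0 ltxx.
Qed.

(** The closed interval is what the compactness argument needs. *)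
Lemma orbit_sum_gt0_finite (N : nat) : exists x : R, 0 <= x <= 1 /\
  forall n, (0 < n <= N)%N -> 0 < orbit_sum theta n x.
Proof.
have [m [p [leN cop approx]]] := odd_approximation N irr.
have [j Hj] := lattice_sum_gt0_exists cop.
have [x Hx] := lattice_le_orbit_sum approx j.
exists (mod1 x); split.
  by have /andP[-> /ltW ->] := mod1_itv x.
move=> n /andP[n0 nN]; rewrite orbit_sum_mod1.
by apply: lt_le_trans (Hj n n0) (Hx n _); lia.
Qed.

(** The value -1 is taken on the open arcs from [k + 1/2] to [k + 1], so it persists nearby; at a
    point of value 1 nothing can exceed it. *)
Lemma circle_sign_usc (c x : R) :
  \forall y \near x, circle_sign (y + c) <= circle_sign (x + c).
Proof.
have [->|/eqP] := circle_sign_pm1 (x + c).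
  by near=> y; have [->|->] := circle_sign_pm1 (y + c).
rewrite {1}/circle_sign; case: ifPn => //; rewrite -ltNge => hx _.
pose k := Num.floor (x + c).
have /andP[_ x1] := mod1_itv (x + c).
have : x \in `](k%:~R + 2^-1 - c), (k%:~R + 1 - c)[.
  by rewrite in_itv /=; rewrite /mod1 -/k in hx x1; apply/andP; split; lra.
move=> /near_in_itvoo; apply: filterS => y; rewrite in_itv /= => /andP[h1 h2].
suff -> : circle_sign (y + c) = -1.
  by have [->|->] := circle_sign_pm1 (x + c).
rewrite /circle_sign ifF // /mod1 (@floor_def _ _ k); last first.
  by rewrite intrD; apply/andP; split; lra.
by apply/negbTE; rewrite -ltNge; lra.
Unshelve. all: by end_near. Qed.

Lemma orbit_sum_usc (n : nat) (x : R) :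
  \forall y \near x, orbit_sum theta n y <= orbit_sum theta n x.
Proof.
elim: n => [|n IH]; first by near=> y; rewrite /orbit_sum !big_ord0.
apply: filterS2 IH (circle_sign_usc (theta *+ n) x) => y h1 h2.
by rewrite /orbit_sum !big_ord_recr lerD.
Unshelve. all: by end_near. Qed.

Lemma orbit_sum_gt0_exists : exists x : R,
  forall n, (0 < n)%N -> 0 < orbit_sum theta n x.
Proof.
have [u uP] := choice orbit_sum_gt0_finite.
have [|x [_ xcl]] := @segment_compact R 0 1 (u @ \oo) _.
  by exists 0%N => // n _ /=; rewrite in_itv /=; have [] := uP n.
exists x => n n0.
(* For fixed [n], all [u N] with [N >= n] qualify, so some such point lies in the neighbourhood
   given by semicontinuity. *)
have uN : (u @ \oo) [set y | 0 < orbit_sum theta n y].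
  by exists n => // N /= le_n; have [_ ->] := uP N; rewrite ?n0.
have [y [/= h1 h2]] := xcl _ _ uN (orbit_sum_usc n x).
exact: lt_le_trans h1 h2.
Qed.

End StrictlyHeavy.

Theorem theorem1 (R : realType) (theta : R) (irr_theta : irrational theta) :
  exists x : R, strictly_heavy theta = [set x].
Proof.
have heavyP (x : R) : 0 <= x < 1 -> (forall n, (0 < n)%N ->
    (0 < birkhoff_sum theta n x) = (0 < orbit_sum theta n x)).
  by move=> x01 n _; rewrite -{1}(mod1_id x01) birkhoff_sumE ltr0z.
have [x Hx] := orbit_sum_gt0_exists irr_theta.
have x01 := mod1_itv x.
have Hmx n : (0 < n)%N -> 0 < orbit_sum theta n (mod1 x).
  by rewrite orbit_sum_mod1; exact: Hx.
(* The point [x] comes without a bound, and a cluster point could be 1; reduction brings it into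
   [[0, 1)] and keeps the orbit sums. *)
exists (mod1 x); apply/seteqP; split => [y [/=]|_ ->] /=.
  rewrite in_itv /= => y01 Hy.
  apply: (orbit_sum_gt0_uniq irr_theta) => // n n0.
  by rewrite -heavyP // Hy.
split; first by rewrite /= in_itv.
by move=> n n0; rewrite heavyP // Hmx.
Qed.
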